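(* Let $g,f\in\mathbb{Z}[[z]]$ with $f(0)=0$, $[z^1]f=1$ and $f\neq z$, and let $G_n^\sigma=G_n^\sigma(g,f)$ be the oriented Riordan graph of order $n$. Suppose that, for some integer $\ell\ge0$, the ternary $A$-sequence of $(g,f)$ has the form $$A=(a_k)_{k\ge0}=(1,\underbrace{0,\ldots,0}_{\ell\text{ times}},a_{\ell+1},a_{\ell+2},\ldots),\qquad a_{\ell+1}\not\equiv0\pmod 3 .$$ Then for every integer $s\ge0$, every $k\in\{0,\ldots,\ell\}$ and every integer $\alpha\ge1$: (i) $\left\langle\{1,\ldots,(k+1)3^{s}+1\}\right\rangle\cong\left\langle\{\alpha(k+1)3^{s}+1,\ldots,(\alpha+1)(k+1)3^{s}+1\}\right\rangle$, whenever $(\alpha+1)(k+1)3^s+1\le n$; (ii) $\left\langle\{1,\ldots,(k+1)3^{s}\}\right\rangle\cong\left\langle\{\alpha(k+1)3^{s}+1,\ldots,(\alpha+1)(k+1)3^{s}\}\right\rangle$, whenever $(\alpha+1)(k+1)3^s\le n$. Here $\cong$ denotes isomorphism of oriented graphs.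
   Context: The skew-adjacency matrix of an oriented graph on $\{1,\dots,n\}$ is $[s_{i,j}]$ with $s_{i,j}=1$, $s_{j,i}=-1$ if $i\to j$ is an arc, and $s_{i,j}=s_{j,i}=0$ if there is no arc between $i$ and $j$. For $g,f\in\mathbb{Z}[[z]]$ with $f(0)=0$, the oriented Riordan graph $G_n^\sigma(g,f)$ is the oriented graph on $\{1,\dots,n\}$ whose skew-adjacency matrix has entries in $\{-1,0,1\}$ with $s_{i,j}\equiv[z^{i-2}]\,g f^{\,j-1}\pmod 3$ for $i>j$ (and $s_{j,i}=-s_{i,j}$, $s_{i,i}=0$), where $[z^k]h$ is the coefficient of $z^k$ in $h$. For a vertex subset $W$, $\langle W\rangle$ denotes the subgraph of $G_n^\sigma$ induced by $W$. $A$-sequence: when $[z^1]f=1$, there is a unique power series $A(z)=\sum_{k\ge0}a_kz^k\in\mathbb{Z}[[z]]$ with $f=z\,A(f)$ (equivalently $A=z/\bar f$, where $\bar f$ is the compositional inverse of $f$). The ternary $A$-sequence of $(g,f)$ is the sequence of coefficients of $A$ reduced modulo $3$ to elements of $\{-1,0,1\}$; it begins with $a_0=1$. *)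

(* Defs.v *)
From HB Require Import structures.
From mathcomp Require Import all_boot all_order all_algebra.

Set Implicit Arguments.
Unset Strict Implicit.
Unset Printing Implicit Defensive.

Import Order.TTheory GRing.Theory Num.Theory.
Local Open Scope ring_scope.

(* Z[[z]]: a series is its coefficient function, so [z^k]h is h k, and
   equality of series is the pointwise equality =1. *)
Definition pseries := nat -> int.

Definition ps1 : pseries := fun k => (k == 0%N)%:R.
Definition psX : pseries := fun k => (k == 1%N)%:R.
Definition psmul (p q : pseries) : pseries :=
  fun k => \sum_(i < k.+1) p i * q (k - i)%N.
Definition psexp (p : pseries) (m : nat) : pseries := iter m (psmul p) ps1.

(* a(f).  Cutting the sum at m = k is correct only if f(0) = 0, since then
   [z^k]f^m = 0 for m > k. *)
Definition pscomp (a f : pseries) : pseries :=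
  fun k => \sum_(m < k.+1) a m * psexp f m k.

Definition is_Aseries (f A : pseries) : Prop := f =1 psmul psX (pscomp A f).

(* The representative of m modulo 3 in {-1, 0, 1}. *)
Definition tern (m : int) : int :=
  if (m %% 3)%Z == 2 then -1 else (m %% 3)%Z.

Lemma tern_mod m : (tern m = m %[mod 3])%Z.
Proof.
rewrite /tern; case: eqP => [e|_]; last by rewrite modz_mod.
by rewrite e.
Qed.

Lemma tern_range m : tern m \in [:: -1; 0; 1].
Proof.
rewrite /tern.
have := modz_ge0 m (isT : (3 : int) != 0).
have := ltz_pmod m (isT : (0 : int) < 3).
by case: (m %% 3)%Z => [[|[|[|k]]]|k].
Qed.

Record orgraph (V : finType) := OrGraph {
  arc :> rel V;
  arc_asym : forall x y, arc x y -> ~~ arc y x }.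

Definition skew_adj n (G : orgraph 'I_n) : 'M[int]_n :=
  \matrix_(i, j) (if G i j then 1 else if G j i then -1 else 0).

Lemma induced_asym (V : finType) (G : orgraph V) (W : {set V})
  (x y : {v : V | v \in W}) : G (val x) (val y) -> ~~ G (val y) (val x).
Proof. exact: arc_asym. Qed.

Definition induced (V : finType) (G : orgraph V) (W : {set V}) :
  orgraph {v : V | v \in W} := OrGraph (@induced_asym V G W).

Definition orgraph_iso (V1 V2 : finType) (G1 : orgraph V1) (G2 : orgraph V2) :
  Prop :=
  exists phi : V1 -> V2,
    bijective phi /\ forall x y, G2 (phi x) (phi y) = G1 x y.

(* The element v of 'I_n stands for the vertex v + 1 of {1, ..., n}. *)
Definition label n (v : 'I_n) : nat := v.+1.

Definition vset n (a b : nat) : {set 'I_n} := [set v | a <= label v <= b]%N.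

(* Used only for labels i > j >= 1, where i - 2 and j - 1 do not truncate. *)
Definition riordan_low (g f : pseries) (i j : nat) : int :=
  tern (psmul g (psexp f (j - 1)) (i - 2)%N).

Definition riordan_mx n (g f : pseries) : 'M[int]_n :=
  \matrix_(i, j)
    if (label j < label i)%N then riordan_low g f (label i) (label j)
    else if (label i < label j)%N then - riordan_low g f (label j) (label i)
    else 0.

Lemma riordan_mx_skew n g f (i j : 'I_n) :
  riordan_mx n g f j i = - riordan_mx n g f i j.
Proof. by rewrite !mxE; case: ltngtP => _; rewrite ?opprK ?oppr0. Qed.

Lemma riordan_mx_range n g f (i j : 'I_n) :
  riordan_mx n g f i j \in [:: -1; 0; 1].
Proof.
by rewrite mxE; case: ltngtP => _ //; rewrite ?tern_range // /riordan_low;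
  move: (tern_range (psmul g (psexp f (label i - 1)) (label j - 2)%N));
  rewrite !inE => /or3P[]/eqP ->.
Qed.

Lemma riordan_asym n g f (i j : 'I_n) :
  riordan_mx n g f i j == 1 -> ~~ (riordan_mx n g f j i == 1).
Proof. by rewrite (riordan_mx_skew g f i j) => /eqP ->. Qed.

Definition riordan_graph n (g f : pseries) : orgraph 'I_n :=
  OrGraph (@riordan_asym n g f).

Lemma skew_adj_riordan n g f :
  skew_adj (riordan_graph n g f) = riordan_mx n g f.
Proof.
apply/matrixP => i j; rewrite mxE /= (riordan_mx_skew g f i j).
by move: (riordan_mx_range g f i j); rewrite !inE => /or3P[]/eqP ->.
Qed.

Lemma psexp_lt f m k : f 0%N = 0 -> (k < m)%N -> psexp f m k = 0.
Proof.
move=> f0; elim: m k => // m IHm k; rewrite ltnS => km.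
rewrite /psexp iterS -/(psexp f m) /psmul big_ord_recl f0 mul0r add0r.
apply: big1 => i _; rewrite IHm ?mulr0 //.
by case: k km i => [|k] km [i Hi] //=; rewrite subSS (leq_ltn_trans (leq_subr _ _)).
Qed.

Lemma psexp_diag f m : f 0%N = 0 -> f 1%N = 1 -> psexp f m m = 1.
Proof.
move=> f0 f1; elim: m => // m IHm.
rewrite /psexp iterS -/(psexp f m) /psmul !big_ord_recl f0 mul0r add0r f1 mul1r.
rewrite subSS subn0 IHm big1 ?addr0 // => i _.
rewrite psexp_lt ?mulr0 //= !subSS.
by case: m {IHm} i => [|m] [i Hi] //=; rewrite subSS ltnS leq_subr.
Qed.

Lemma is_AseriesP f A : f 0%N = 0 ->
  is_Aseries f A <-> forall k, f k.+1 = pscomp A f k.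
Proof.
move=> f0; rewrite /is_Aseries; have mulXE k : psmul psX (pscomp A f) k.+1 = pscomp A f k.
  by rewrite /psmul !big_ord_recl mul0r add0r mul1r big1 ?addr0 ?subSS ?subn0 // => i _; rewrite mul0r.
split=> [H k|H [|k]]; first by rewrite H mulXE.
- by rewrite f0 /psmul big_ord_recl big_ord0 mul0r addr0.
by rewrite mulXE.
Qed.

Lemma Aseries_exists f : f 0%N = 0 -> f 1%N = 1 -> exists A, is_Aseries f A.
Proof.
move=> f0 f1.
pose step (s : seq int) :=
  rcons s (f (size s).+1 - \sum_(m < size s) s`_m * psexp f m (size s)).
pose S k := iter k step [::].
have szS k : size (S k) = k by elim: k => //= k IHk; rewrite size_rcons IHk.
have stab k d i : (i < k)%N -> (S (d + k)%N)`_i = (S k)`_i.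
  move=> ik; elim: d => // d IHd.
  by rewrite addSn /= nth_rcons szS (leq_trans ik (leq_addl _ _)).
have stab' k i : (i < k)%N -> (S k)`_i = (S i.+1)`_i.
  by move=> ik; rewrite -[in LHS](subnK ik) stab.
exists (fun k => (S k.+1)`_k); apply/is_AseriesP => // k.
rewrite /pscomp big_ord_recr /= psexp_diag // mulr1 nth_rcons szS ltnn eqxx.
rewrite addrC -[LHS]addr0 -addrA; congr (_ + _); apply/esym/eqP.
rewrite addrC subr_eq0; apply/eqP; apply: eq_bigr => i _; congr (_ * _).
by rewrite stab'.
Qed.

Lemma Aseries_unique f A B : f 0%N = 0 -> f 1%N = 1 ->
  is_Aseries f A -> is_Aseries f B -> A =1 B.
Proof.
move=> f0 f1 /is_AseriesP-/(_ f0) HA /is_AseriesP-/(_ f0) HB k.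
elim/ltn_ind: k => k IHk; move: (HA k); rewrite HB /pscomp !big_ord_recr /=.
rewrite psexp_diag // !mulr1 => /esym.
rewrite (eq_bigr (fun m : 'I_k => B m * psexp f m k)); first exact: addrI.
by move=> i _; rewrite IHk.
Qed.

(* Main.v *)
Require Import Defs.
From mathcomp Require Import all_boot all_order all_algebra.
From mathcomp Require Import zify ring.
Import Order.TTheory GRing.Theory Num.Theory.
Local Open Scope ring_scope.

(** Modulo 3 the recursion [f = z A(f)] gives [f = z (1 + O(z^(l+1)))].  Cubing
    is additive in characteristic 3, so [f^(3^s) = z^(3^s) (1 + O(z^L))] with
    [L = (l+1) 3^s], and therefore [f^M = z^M (1 + O(z^L))] whenever [3^s]
    divides [M].  Comparing coefficients, the entry [(i+M, j+M)] of the
    skew-adjacency matrix equals the entry [(i, j)] as soon as [|i - j| <= L],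
    so translation by [M] is the isomorphism in both cases. *)

Lemma intrF3_eq0 (m : int) : (m%:~R == 0 :> 'F_3) = (3 %| m)%Z.
Proof.
have natF3 (k : nat) : (k%:R == 0 :> 'F_3) = (3 %| k)%N.
  by rewrite (dvdn_pcharf (pchar_Fp (isT : prime 3))).
by rewrite [m]intEsign rmorphM rmorph_sign mulf_eq0 signr_eq0 /= natF3 dvdzE abszMsign.
Qed.

Lemma ternE (m p : int) : m%:~R = p%:~R :> 'F_3 -> tern m = tern p.
Proof.
move/eqP; rewrite -subr_eq0 -rmorphB intrF3_eq0 -eqz_mod_dvd => /eqP e.
by rewrite /tern e.
Qed.

Lemma tern_eq0 (m : int) : tern m = 0 -> m%:~R = 0 :> 'F_3.
Proof.
move=> e; apply/eqP; rewrite intrF3_eq0; apply/dvdz_mod0P.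
by rewrite -tern_mod e.
Qed.

(** Truncation moves the computation into a commutative ring of characteristic 3, where Frobenius
    and [ring] apply. *)
Definition trunc3 (N : nat) (p : pseries) : {poly 'F_3} :=
  \poly_(i < N) (p i)%:~R.

Lemma coef_trunc3 N p k : (k < N)%N -> (trunc3 N p)`_k = (p k)%:~R.
Proof. by move=> kN; rewrite coef_poly kN. Qed.

(** [P] and [Q] need only agree with the series below [N]: a power of a truncation is in general not
    itself a truncation. *)
Lemma coef_trunc3_mul N p q (P Q : {poly 'F_3}) :
    (forall k, (k < N)%N -> P`_k = (p k)%:~R) ->
    (forall k, (k < N)%N -> Q`_k = (q k)%:~R) ->
  forall k, (k < N)%N -> (P * Q)`_k = (psmul p q k)%:~R.
Proof.
move=> hP hQ k kN; rewrite coefM /psmul rmorph_sum /=; apply: eq_bigr => i _.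
by rewrite rmorphM hP ?hQ //; have := ltn_ord i; lia.
Qed.

Lemma coef_trunc3_exp N p m k :
  (k < N)%N -> (trunc3 N p ^+ m)`_k = (psexp p m k)%:~R.
Proof.
elim: m k => [|m IHm] k kN; first by rewrite expr0 coef1 rmorph_nat.
rewrite exprS; apply: coef_trunc3_mul kN => // i iN; exact: coef_trunc3.
Qed.

Lemma Aseries_coef3 (f A : pseries) (l k : nat) :
    f 0%N = 0 -> is_Aseries f A ->
    (forall k, (1 <= k <= l)%N -> tern (A k) = 0) ->
  (1 <= k <= l)%N -> (f k.+1)%:~R = 0 :> 'F_3.
Proof.
move=> f0 /(is_AseriesP _ f0) fA az /andP[k0 kl].
rewrite fA /pscomp rmorph_sum big1 //= => -[[|m] mk] _; rewrite rmorphM /=.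
  (* The term [m = 0] has the nonzero factor [A 0], but [f^0 = 1] has no coefficient in degree
     [k > 0]. *)
  by rewrite /psexp /= /ps1 eqn0Ngt k0 mulr0.
by rewrite tern_eq0 ?mul0r // az //=; lia.
Qed.

Lemma trunc3_factor (f A : pseries) (l N : nat) :
    f 0%N = 0 -> f 1%N = 1 -> is_Aseries f A ->
    (forall k, (1 <= k <= l)%N -> tern (A k) = 0) -> (1 < N)%N ->
  exists v, trunc3 N f = 'X * (1 + 'X^(l.+1) * v).
Proof.
move=> f0 f1 fA az N1; exists (drop_poly l.+2 (trunc3 N f)).
rewrite -[LHS](poly_take_drop l.+2) mulrDr mulr1 mulrA -exprS [_ * 'X^_]mulrC.
congr (_ + _); apply/polyP => -[|[|k]]; rewrite coef_take_poly coefX /=.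
- by rewrite coef_poly f0; case: ifP.
- by rewrite coef_poly N1 f1.
case: ltnP => // kl; rewrite coef_poly; case: ifP => // _.
by apply: (Aseries_coef3 f A l).
Qed.

Lemma cubed_factor (P v : {poly 'F_3}) (l s b : nat) :
    P = 'X * (1 + 'X^l * v) ->
  exists w, P ^+ (b * 3 ^ s) = 'X^(b * 3 ^ s) * (1 + 'X^(l * 3 ^ s) * w).
Proof.
move=> ->; have cubing : (1 + 'X^l * v) ^+ (3 ^ s)
    = 1 + 'X^(l * 3 ^ s) * v ^+ (3 ^ s) :> {poly 'F_3}.
  rewrite exprDn_pchar ?expr1n ?exprMn -?exprM //.
  by rewrite pnatX pnatE // pchar_poly pchar_Fp.
rewrite exprMn; have -> : (1 + 'X^l * v) ^+ (b * 3 ^ s)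
    = (1 + 'X^(l * 3 ^ s) * v ^+ (3 ^ s)) ^+ b.
  by rewrite -cubing -exprM mulnC.
move: {v cubing} ('X^(l * _)) (v ^+ _) => x v.
suff [w ->] : exists w, (1 + x * v) ^+ b = 1 + x * w by exists w.
elim: b => [|b [w IHb]]; first by exists 0; rewrite expr0 mulr0 addr0.
by exists (v + w + x * v * w); rewrite exprS IHb; ring.
Qed.

Lemma riordan_low_shift (g f A : pseries) (l s b i j : nat) :
    f 0%N = 0 -> f 1%N = 1 -> is_Aseries f A ->
    (forall k, (1 <= k <= l)%N -> tern (A k) = 0) ->
    (1 <= j < i)%N -> (i <= j + l.+1 * 3 ^ s)%N ->
  riordan_low g f (i + b * 3 ^ s) (j + b * 3 ^ s) = riordan_low g f i j.
Proof.
move=> f0 f1 fA az ji ijL; apply: ternE.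
(* This [N] exceeds both coefficient indices, [i + M - 2] and [i - 2]. *)
set M := (b * 3 ^ s)%N; pose N := (i + M)%N.
have coefE m k : (k < N)%N ->
    (psmul g (psexp f m) k)%:~R = (trunc3 N g * trunc3 N f ^+ m)`_k.
  move=> kN; apply/esym; apply: coef_trunc3_mul kN => t tN.
    exact: coef_trunc3.
  exact: coef_trunc3_exp.
rewrite !coefE; [|lia|lia].
have [v eqF] : exists v, trunc3 N f = 'X * (1 + 'X^(l.+1) * v).
  by apply: trunc3_factor fA az _ => //; lia.
have [w eqFM] := cubed_factor _ _ _ s b eqF.
have -> : (j + M - 1 = (j - 1) + M)%N by lia.
rewrite exprD eqFM -/M; set G := trunc3 N g; set F := trunc3 N f.
(* The error term keeps the factor ['X^(j - 1)] coming from [F ^+ (j - 1)]; without it the bound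
   would restrict [i] instead of [i - j]. *)
have -> : G * (F ^+ (j - 1) * ('X^M * (1 + 'X^(l.+1 * 3 ^ s) * w)))
    = 'X^M * (G * F ^+ (j - 1)
      + 'X^(l.+1 * 3 ^ s) * 'X^(j - 1)
        * (G * (1 + 'X^(l.+1) * v) ^+ (j - 1) * w)).
  rewrite /F eqF exprMn; move: (_ ^+ (j - 1)) (_ ^+ (j - 1)) => p q.
  by move: ('X^M) ('X^(_ * _)) => x y; ring.
rewrite coefXnM ifF; last by lia.
have -> : (i + M - 2 - M = i - 2)%N by lia.
(* The error starts in degree [l.+1 * 3 ^ s + (j - 1)], which exceeds [i - 2] exactly when
   [i <= j + l.+1 * 3 ^ s]. *)
by rewrite coefD -exprD coefXnM ifT ?addr0 //; lia.
Qed.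

(** Translation by [M] preserves the order of labels, so by skew-symmetry agreement below the
    diagonal suffices. *)
Lemma riordan_iso_shift n (g f : pseries) (a b M : nat) :
    (0 < a)%N -> (b + M <= n)%N ->
    (forall i j, (a <= j)%N -> (j < i)%N -> (i <= b)%N ->
       riordan_low g f (i + M) (j + M) = riordan_low g f i j) ->
  orgraph_iso (induced (riordan_graph n g f) (vset n a b))
              (induced (riordan_graph n g f) (vset n (a + M) (b + M))).
Proof.
move=> a_gt0 bMn low_shift.
(* [up] and [down] carry their defining equations, so that both cancellation laws reduce to
   cancelling [M]. *)
have up (x : {v : 'I_n | v \in vset n a b}) :
    {y : {v : 'I_n | v \in vset n (a + M) (b + M)} | val (val y) = (val (val x) + M)%N}.
  case: x => x /=; rewrite inE /label => xab.
  have xn : (x + M < n)%N by lia.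
  have xW : Ordinal xn \in vset n (a + M) (b + M) by rewrite inE /label /=; lia.
  by exists (exist _ (Ordinal xn) xW).
have down (y : {v : 'I_n | v \in vset n (a + M) (b + M)}) :
    {x : {v : 'I_n | v \in vset n a b} | val (val y) = (val (val x) + M)%N}.
  case: y => y /=; rewrite inE /label => yab.
  have yn : (y - M < n)%N by have := ltn_ord y; lia.
  have yW : Ordinal yn \in vset n a b by rewrite inE /label /=; lia.
  by exists (exist _ (Ordinal yn) yW) => /=; lia.
exists (fun x => sval (up x)); split.
  exists (fun y => sval (down y)) => [x|y]; apply/val_inj/val_inj.
    by apply: (@addIn M); rewrite -(svalP (down _)) (svalP (up _)).
  by rewrite (svalP (up _)) -(svalP (down _)).
move=> x y; rewrite /= /induced /= !mxE /label !(svalP (up _)) -!addSn !leq_add2r.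
have := valP x; have := valP y; rewrite !inE => /andP[ay yb] /andP[ax xb].
by case: ltngtP => // lt; rewrite low_shift.
Qed.

Theorem theorem3p4 (g f A : pseries) (n l : nat)
  (f0 : f 0%N = 0) (f1 : f 1%N = 1) (fX : ~ (f =1 psX))
  (fA : is_Aseries f A)
  (a0 : tern (A 0%N) = 1)
  (az : forall k : nat, (1 <= k <= l)%N -> tern (A k) = 0)
  (al : (tern (A l.+1) != 0 %[mod 3])%Z)
  (s k alpha : nat) (hk : (k <= l)%N) (halpha : (1 <= alpha)%N) :
  (((alpha + 1) * (k + 1) * 3 ^ s + 1 <= n)%N ->
     orgraph_iso
       (induced (riordan_graph n g f) (vset n 1 ((k + 1) * 3 ^ s + 1)))
       (induced (riordan_graph n g f)
          (vset n (alpha * (k + 1) * 3 ^ s + 1)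
                  ((alpha + 1) * (k + 1) * 3 ^ s + 1))))
  /\
  (((alpha + 1) * (k + 1) * 3 ^ s <= n)%N ->
     orgraph_iso
       (induced (riordan_graph n g f) (vset n 1 ((k + 1) * 3 ^ s)))
       (induced (riordan_graph n g f)
          (vset n (alpha * (k + 1) * 3 ^ s + 1)
                  ((alpha + 1) * (k + 1) * 3 ^ s)))).
Proof.
have low_shift i j : (1 <= j)%N -> (j < i)%N -> (i <= (k + 1) * 3 ^ s + 1)%N ->
    riordan_low g f (i + alpha * (k + 1) * 3 ^ s) (j + alpha * (k + 1) * 3 ^ s)
    = riordan_low g f i j.
  (* Since [j >= 1], even the larger vertex set of (i) has [i - j <= (k + 1) * 3 ^ s], and [k <= l]
     gives the required bound. *)
  move=> j1 ji ib; apply: (riordan_low_shift g f A l) => //; first by rewrite j1.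
  apply: leq_trans ib _; rewrite addnC leq_add // leq_mul2r; lia.
have -> : ((alpha + 1) * (k + 1) * 3 ^ s
    = (k + 1) * 3 ^ s + alpha * (k + 1) * 3 ^ s)%N by ring.
rewrite addnAC [(alpha * _ * _ + 1)%N]addnC.
split=> bn; apply: riordan_iso_shift => // i j j1 ji ib; apply: low_shift => //.
by rewrite addn1 leqW.
Qed.
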